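(* Let $\mathcal{C}_N$ be a weighted cycle on $N$ vertices. Then for every $1\leq k\leq N$, \[ 2-\lambda_{N-k+1}\geq C_3\bigl(1-\overline{h}(k-1)\bigr)^2, \] with the convention $\overline{h}(0):=\overline{h}(1)$, where $C_3=\frac12$ if $N-k+1$ is odd or $N-k+1\in\{N-1,N\}$, and $C_3=\frac1{48}$ if $N-k+1\leq N-2$ is even.
   Context: A weighted cycle $\mathcal{C}_N$ ($N\geq3$) is a graph on vertices $v_1,\ldots,v_N$ whose edges are exactly $\{v_i,v_{i+1}\}$ (indices mod $N$), each with a positive weight $w_{uv}=w_{vu}$. Degrees $d_u=\sum_vw_{uv}$, $|E(A,B)|:=\sum_{u\in A,v\in B}w_{uv}$, $\mathrm{vol}(A)=\sum_{u\in A}d_u$. The normalized Laplacian $\Delta f(u)=\frac{1}{d_u}\sum_vw_{uv}(f(u)-f(v))$ has eigenvalues (with multiplicity) $0=\lambda_1\leq\cdots\leq\lambda_N\leq2$. For disjoint $V_1,V_2$ with $V_1\cup V_2\neq\emptyset$, $\overline{\phi}(V_1,V_2)=2|E(V_1,V_2)|/\mathrm{vol}(V_1\cup V_2)$; $\overline{h}(k):=\max\min_{1\leq i\leq k}\overline{\phi}(V_{2i-1},V_{2i})$ over all collections of $k$ pairs $(V_1,V_2),\ldots,(V_{2k-1},V_{2k})$ of pairwise disjoint subsets of the vertex set with $V_{2i-1}\cup V_{2i}\neq\emptyset$ for each $i$. *)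

(* Defs.v *)
From HB Require Import structures.
From mathcomp Require Import all_boot all_order all_algebra.
Set Implicit Arguments. Unset Strict Implicit. Unset Printing Implicit Defensive.
Import Order.TTheory GRing.Theory Num.Theory.
Local Open Scope ring_scope.

(* Weighted cycle C_N on vertices 'I_N (v_{i+1} is vertex i).  The weight
   w i > 0 is the weight of the edge {i, i+1 mod N}.  For N >= 3 the two
   terms below are mutually exclusive. *)
Section Cycle.
Variables (R : realFieldType) (N : nat) (w : 'I_N -> R).

Definition cw (u v : 'I_N) : R :=
  (if (v : nat) == (u.+1 %% N)%N then w u else 0) +
  (if (u : nat) == (v.+1 %% N)%N then w v else 0).

Definition cdeg (u : 'I_N) : R := \sum_(v : 'I_N) cw u v.

Definition cE (A B : {set 'I_N}) : R := \sum_(u in A) \sum_(v in B) cw u v.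

Definition cvol (A : {set 'I_N}) : R := \sum_(u in A) cdeg u.

Definition phibar (A B : {set 'I_N}) : R := 2 * cE A B / cvol (A :|: B).

Definition nlap : 'M[R]_N :=
  \matrix_(u, v) ((u == v)%:R - cw u v / cdeg u).

Definition admissible k (c : {ffun 'I_k -> {set 'I_N} * {set 'I_N}}) : bool :=
  [forall i, [disjoint (c i).1 & (c i).2] && ((c i).1 :|: (c i).2 != set0)] &&
  [forall i, forall j, (i != j) ==>
     [&& [disjoint (c i).1 & (c j).1], [disjoint (c i).1 & (c j).2],
         [disjoint (c i).2 & (c j).1] & [disjoint (c i).2 & (c j).2]]].

(* min_{1<=i<=k} phibar(V_{2i-1},V_{2i}); the default 1 is harmless for
   k >= 1 since phibar <= 1 *)
Definition minphi k (c : {ffun 'I_k -> {set 'I_N} * {set 'I_N}}) : R :=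
  \big[Num.min/1]_(i < k) phibar (c i).1 (c i).2.

(* hbar(k) = max over admissible collections; the default 0 is harmless
   since phibar >= 0 and admissible collections exist for 1 <= k <= N *)
Definition hbar k : R :=
  \big[Num.max/0]_(c : {ffun 'I_k -> {set 'I_N} * {set 'I_N}} | admissible c)
     minphi c.

Definition hbar' k : R := if k == 0%N then hbar 1 else hbar k.

End Cycle.

Definition eigenvalues_sorted (R : realFieldType) (N : nat) (M : 'M[R]_N)
  (lam : seq R) : Prop :=
  [/\ size lam = N, sorted <=%R lam &
      char_poly M = \prod_(x <- lam) ('X - x%:P)].

(* Main.v *)
Require Import Defs.
From HB Require Import structures.
From mathcomp Require Import all_boot all_order all_algebra ring lra.
Import Order.TTheory GRing.Theory Num.Theory.
Local Open Scope ring_scope.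

(* Put mu = 2 - lambda_(N-k+1), an eigenvalue of the signless Laplacian, whose
   form is the sum of w (f(u) + f(u'))^2 over the edges {u, u'}, and let f be an
   eigenvector.  Call a vertex a break if f vanishes there or has the same strict
   sign as at the preceding vertex.  If there were fewer than k - 1 breaks, the
   span of the eigenvectors with signless eigenvalue <= mu would contain a nonzero
   g proportional to f across every break and vanishing at a vertex where f does
   not; the ground state transform g = c f shows that g is again an eigenvector
   for mu, with zero Wronskian against f, whence g = 0.  So there are at least
   k - 1 breaks, and when k >= 3 they cut the cycle into as many alternating arcs.
   The restriction of f to an arc has Rayleigh quotient at most mu, and the dual
   Cheeger inequality gives a pair inside each arc with
   (1 - phibar)^2 <= 2 mu.  For k <= 2 the same inequality is applied to f itself.
   The constant 1/2 thus works for every k. *)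

Set Implicit Arguments. Unset Strict Implicit. Unset Printing Implicit Defensive.

(** * Characteristic polynomials and diagonal forms *)

Lemma char_poly_tr (R : comNzRingType) n (A : 'M[R]_n) : char_poly A^T = char_poly A.
Proof.
rewrite /char_poly -[RHS]det_tr; congr (\det _).
by rewrite /char_poly_mx linearB /= tr_scalar_mx map_trmx.
Qed.

Lemma char_poly_intertwine (F : fieldType) n (P A B : 'M[F]_n) :
  P \in unitmx -> P *m A = B *m P -> char_poly A = char_poly B.
Proof.
move=> Pu PAB; pose Q := map_mx (@polyC F) P.
have QE : Q *m char_poly_mx A = char_poly_mx B *m Q.
  rewrite /char_poly_mx mulmxBr mulmxBl -!map_mxM PAB; congr (_ - _).
  by rewrite scalar_mxC.
have detQ : \det Q != 0.
  by rewrite /Q det_map_mx polyC_eq0 -unitfE -unitmxE.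
apply: (mulfI detQ); rewrite /char_poly.
by rewrite -det_mulmx QE det_mulmx mulrC.
Qed.

Lemma mul_diag_mx_tr (R : comNzRingType) n (x d : 'rV[R]_n) :
  (x *m diag_mx d *m x^T) 0 0 = \sum_i d 0 i * x 0 i ^+ 2.
Proof.
rewrite mul_mx_diag mxE; apply: eq_bigr => i _.
by rewrite !mxE mulrAC mulrC expr2.
Qed.

Lemma prod_XsubC_dvd_exp_undup (F : fieldType) (s : seq F) :
  \prod_(x <- s) ('X - x%:P) %| (\prod_(x <- undup s) ('X - x%:P)) ^+ size s.
Proof.
set p := \prod_(x <- undup s) _.
have dvdXp x : x \in s -> 'X - x%:P %| p.
  by move=> xs; rewrite dvdp_XsubCl root_prod_XsubC mem_undup.
elim: s p dvdXp => [|x s IHs] p dvdXp; first by rewrite big_nil dvd1p.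
rewrite big_cons exprS dvdp_mul ?dvdXp ?mem_head // IHs // => y ys.
by rewrite dvdXp // inE ys orbT.
Qed.

(** * Operators self-adjoint for a positive diagonal form *)

Section Spectral.
Variables (R : rcfType) (n' : nat).
Local Notation n := n'.+1.
Variables (d : 'rV[R]_n) (T : 'M[R]_n).
Hypothesis d_gt0 : forall i, 0 < d 0 i.
Local Notation D := (diag_mx d).
Hypothesis TD : D *m T^T = T *m D.

Lemma diag_form_ge0 (x : 'rV[R]_n) : 0 <= (x *m D *m x^T) 0 0.
Proof.
rewrite mul_diag_mx_tr sumr_ge0 // => i _.
by rewrite mulr_ge0 ?sqr_ge0 // ltW.
Qed.

Lemma diag_form_eq0 (x : 'rV[R]_n) : (x *m D *m x^T) 0 0 = 0 -> x = 0.
Proof.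
rewrite mul_diag_mx_tr => /eqP; rewrite psumr_eq0; last first.
  by move=> i _; rewrite mulr_ge0 ?sqr_ge0 // ltW.
move=> /allP x0; apply/rowP => i; apply/eqP; rewrite mxE.
by have := x0 i (mem_index_enum i); rewrite /= mulf_eq0 gt_eqF //= sqrf_eq0.
Qed.

Lemma self_adjoint_horner (p : {poly R}) :
  D *m (horner_mx T p)^T = horner_mx T p *m D.
Proof.
elim/poly_ind: p => [|p c IHp]; first by rewrite !rmorph0 trmx0 mulmx0 mul0mx.
rewrite rmorphD rmorphM /= horner_mx_X horner_mx_C linearD /= tr_scalar_mx.
rewrite mulmxDl mulmxDr scalar_mxC; congr (_ + _).
have comm : horner_mx T p * T = T * horner_mx T p.
  by rewrite -[X in _ * X](horner_mx_X T) -rmorphM mulrC rmorphM /= horner_mx_X.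
rewrite [in LHS]comm -!mulmxE.
by rewrite trmx_mul mulmxA IHp -!mulmxA TD.
Qed.

(** If [q] is self-adjoint and [q ^+ 2 = 0], the [D]-norm of [x q] is the pairing of [x q^2] with
    [x], which is 0. Halving exponents settles the powers [2 ^ j], and [k <= 2 ^ k]. *)
Lemma self_adjoint_nilpotent (p : {poly R}) k :
  horner_mx T (p ^+ k) = 0 -> horner_mx T p = 0.
Proof.
have sq q : horner_mx T (q ^+ 2) = 0 -> horner_mx T q = 0.
  rewrite expr2 rmorphM /= => q0; apply/row_matrixP => i; rewrite row0.
  apply: diag_form_eq0; rewrite !rowE trmx_mul -!mulmxA.
  rewrite (mulmxA D) self_adjoint_horner 2!(mulmxA (horner_mx T q)).
  by rewrite -mulmxA [horner_mx T q *m horner_mx T q]q0 !mul0mx mulmx0 mxE.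
suff pow j : horner_mx T (p ^+ (2 ^ j)) = 0 -> horner_mx T p = 0.
  move=> pk0; apply: (pow k).
  have /subnKC <- : (k <= 2 ^ k)%N by rewrite ltnW // ltn_expl.
  by rewrite exprD rmorphM /= pk0 mul0r.
by elim: j => [|j IHj]; rewrite ?expr1 // expnSr exprM => /sq.
Qed.

(** By Cayley-Hamilton a power of the product over [undup lam] kills [T], so the product itself
    does, and the minimal polynomial has simple roots. The rows of [P] are eigenvectors, not
    necessarily orthogonal. *)
Lemma self_adjoint_diag (lam : seq R) :
    char_poly T = \prod_(x <- lam) ('X - x%:P) ->
  exists (P : 'M[R]_n) (del : 'rV[R]_n),
    [/\ P \in unitmx, P *m T = diag_mx del *m P
      & perm_eq lam [seq del 0 i | i <- enum 'I_n]].
Proof.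
move=> charT.
have : diagonalizable T.
  apply/diagonalizableP; exists (undup lam); first exact: undup_uniq.
  apply/mxminpoly_min/(self_adjoint_nilpotent (k := size lam)).
  have /dvdpP[q ->] : char_poly T %| (\prod_(x <- undup lam) ('X - x%:P)) ^+ size lam.
    by rewrite charT prod_XsubC_dvd_exp_undup.
  by rewrite rmorphM /= Cayley_Hamilton mulr0.
case=> P Pu /diagonalizable_forPex[del /(simmxP Pu) PT].
exists P, del; split => //; apply: prod_XsubC_eq.
rewrite -charT (char_poly_intertwine Pu PT).
rewrite char_poly_trig ?diag_mx_is_trig // big_map big_enum /=.
by apply: eq_bigr => i _; rewrite mxE eqxx.
Qed.

(* In the eigenbasis the Gram matrix [G] of [D] commutes with [diag_mx del], so
   on the span of the eigenvectors with [lam0 <= del 0 i] the form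
   [x (T - lam0) D x^T] is the [D]-norm of [x] with coordinates rescaled by
   [sqrt (del 0 i - lam0)]. *)
Lemma constrained_large_eigenspan (lam : seq R) (lam0 : R) r (B : 'M[R]_(n, r)) :
    char_poly T = \prod_(x <- lam) ('X - x%:P) ->
    (r < count (>= lam0) lam)%N ->
  exists x : 'rV[R]_n,
    [/\ x != 0, x *m B = 0,
        lam0 * (x *m D *m x^T) 0 0 <= (x *m T *m D *m x^T) 0 0 &
        (x *m T *m D *m x^T) 0 0 <= lam0 * (x *m D *m x^T) 0 0 ->
          x *m T = lam0 *: x].
Proof.
move=> /self_adjoint_diag [P [del [Pu PT /permP ->]]].
rewrite count_map -sum1_count big_enum_cond /= => ltr.
pose I := [set i | lam0 <= del 0 i].
have {}ltr : (r < #|I|)%N.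
  by rewrite -sum1_card (eq_bigl _ _ (fun i => in_set _ i)).
have [y [y_neq0 yPB yNI]] : exists y : 'rV[R]_n,
    [/\ y != 0, y *m P *m B = 0 & forall j, j \notin I -> y 0 j = 0].
  (* [C] embeds the coordinates in [I]; there the [r < #|I|] conditions have a nonzero solution. *)
  pose C : 'M[R]_(#|I|, n) := \matrix_(i, j) (enum_val i == j)%:R.
  have /rowV0Pn[y /sub_kermxP yK y_neq0] : kermx (C *m P *m B) != 0.
    by rewrite -mxrank_eq0 mxrank_ker subn_eq0 -ltnNge (leq_ltn_trans (rank_leq_col _)).
  exists (y *m C); split.
  - apply: contra_neq y_neq0 => yC0; apply/rowP => i.
    have /rowP/(_ (enum_val i)) := yC0; rewrite !mxE => <-.
    rewrite (bigD1 i) //= mxE eqxx mulr1 big1 ?addr0 // => j ji.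
    by rewrite mxE (inj_eq enum_val_inj) (negbTE ji) mulr0.
  - by rewrite -!mulmxA -[RHS]yK !mulmxA.
  - move=> j jI; rewrite mxE big1 // => i _; rewrite mxE.
    case: eqP => [ij|_]; last by rewrite mulr0.
    by rewrite -ij enum_valP in jI.
pose G := P *m D *m P^T.
have GC i j : G i j != 0 -> del 0 i = del 0 j.
  have : diag_mx del *m G = G *m diag_mx del.
    rewrite /G !mulmxA -PT -!mulmxA -(tr_diag_mx del) -trmx_mul -PT trmx_mul.
    by rewrite (mulmxA D) TD -!mulmxA.
  move=> /matrixP/(_ i j); rewrite mul_diag_mx mul_mx_diag !mxE mulrC.
  by move=> + G0 => /(mulfI G0).
pose s : 'rV[R]_n := \row_i (if i \in I then Num.sqrt (del 0 i - lam0) * y 0 i else 0).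
have formE (a b : 'rV[R]_n) : (a *m P *m D *m (b *m P)^T) 0 0 =
    \sum_i \sum_j a 0 i * b 0 j * G i j.
  have -> : a *m P *m D *m (b *m P)^T = a *m G *m b^T.
    by rewrite /G trmx_mul !mulmxA.
  rewrite mxE exchange_big /=; apply: eq_bigr => j _; rewrite mxE mulr_suml.
  by apply: eq_bigr => i _; rewrite !mxE mulrAC.
clearbody G.
have sE : (y *m P *m T *m D *m (y *m P)^T) 0 0 -
    lam0 * (y *m P *m D *m (y *m P)^T) 0 0 = (s *m P *m D *m (s *m P)^T) 0 0.
  rewrite -(mulmxA y) PT mulmxA !formE mulr_sumr -sumrB; apply: eq_bigr => i _.
  rewrite mulr_sumr -sumrB; apply: eq_bigr => j _.
  rewrite mul_mx_diag !mxE.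
  have [->|/GC dij] := eqVneq (G i j) 0; first by rewrite !mulr0 subrr.
  have [iI|/yNI ->] := boolP (i \in I); last by rewrite !(mul0r, mulr0) subrr.
  have jI : j \in I by move: iI; rewrite !inE dij.
  rewrite jI -dij.
  have sq : Num.sqrt (del 0 i - lam0) * Num.sqrt (del 0 i - lam0) = del 0 i - lam0.
    by rewrite -expr2 sqr_sqrtr // subr_ge0; move: iI; rewrite inE.
  rewrite [in RHS]mulrACA sq; ring.
exists (y *m P); split.
- by apply: contra_neq y_neq0 => yP0; rewrite -(mulmxK Pu y) yP0 mul0mx.
- exact: yPB.
- by rewrite -subr_ge0 sE diag_form_ge0.
rewrite -subr_le0 sE => s_le0.
have /diag_form_eq0 sP0 : (s *m P *m D *m (s *m P)^T) 0 0 = 0.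
  by apply/eqP; rewrite eq_le s_le0 diag_form_ge0.
have s0 : s = 0 by rewrite -(mulmxK Pu s) sP0 mul0mx.
rewrite -mulmxA PT mulmxA scalemxAl; congr (_ *m _).
apply/rowP => i; rewrite mul_mx_diag mxE [RHS]mxE.
have [iI|/yNI ->] := boolP (i \in I); last by rewrite mul0r mulr0.
have /rowP/(_ i) := s0; rewrite !mxE iI => /eqP; rewrite mulf_eq0 sqrtr_eq0.
move=> /orP[del_le|/eqP ->]; last by rewrite mul0r mulr0.
suff -> : del 0 i = lam0 by rewrite mulrC.
by apply/eqP; rewrite eq_le -subr_le0 del_le; move: iI; rewrite inE.
Qed.
End Spectral.

(** * The signless quadratic form of the cycle *)

Section SignlessForm.
Variables (R : realFieldType) (N : nat) (w : 'I_N -> R).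
Hypothesis w_gt0 : forall i, 0 < w i.

Definition signless_energy (f : 'I_N -> R) : R :=
  \sum_u w u * (f u + f (ordS u)) ^+ 2.

Definition deg_norm (f : 'I_N -> R) : R := \sum_u cdeg w u * f u ^+ 2.

(** The eigenvalue equation of [2 - nlap w], cleared of the division by the degree. *)
Definition signless_eigen (mu : R) (f : 'I_N -> R) : Prop :=
  forall u, w u * (f u + f (ordS u)) + w (ord_pred u) * (f u + f (ord_pred u)) =
            mu * cdeg w u * f u.

Lemma sum_cw_row (u : 'I_N) (h : 'I_N -> R) :
  \sum_v cw w u v * h v = w u * h (ordS u) + w (ord_pred u) * h (ord_pred u).
Proof.
under eq_bigr do rewrite mulrDl; rewrite big_split /=; congr (_ + _).
  rewrite (bigD1 (ordS u)) //= eqxx big1 ?addr0 // => v.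
  by rewrite -val_eqE /= => /negbTE ->; rewrite mul0r.
rewrite (bigD1 (ord_pred u)) //= big1 ?addr0 => [|v].
  by have /(congr1 val) /= -> := ord_predK u; rewrite eqxx.
rewrite -(inj_eq (can_inj (@ordSK N))) ord_predK -val_eqE /= eq_sym.
by move=> /negbTE ->; rewrite mul0r.
Qed.

Lemma cdegE (u : 'I_N) : cdeg w u = w u + w (ord_pred u).
Proof.
by have := sum_cw_row u (fun=> 1); rewrite !mulr1; under eq_bigr do rewrite mulr1.
Qed.

Lemma cdeg_gt0 (u : 'I_N) : 0 < cdeg w u.
Proof. by rewrite cdegE addr_gt0. Qed.

Lemma sum_ordS (h : 'I_N -> R) : \sum_u h (ordS u) = \sum_u h u.
Proof. by rewrite [RHS](reindex _ (onW_bij _ (@ordS_bij N))). Qed.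

Lemma sum_edges (h : 'I_N -> 'I_N -> R) :
  \sum_u (w u * h u (ordS u) + w (ord_pred u) * h u (ord_pred u)) =
  \sum_u w u * (h u (ordS u) + h (ordS u) u).
Proof.
rewrite big_split /= -[X in _ + X]sum_ordS -big_split /=.
by apply: eq_bigr => u _; rewrite ordSK mulrDr.
Qed.

Lemma sum_cdeg (h : 'I_N -> R) :
  \sum_u cdeg w u * h u = \sum_u w u * (h u + h (ordS u)).
Proof.
rewrite -(sum_edges (fun u _ => h u)); apply: eq_bigr => u _.
by rewrite cdegE mulrDl.
Qed.

Lemma deg_norm_gt0 (f : 'I_N -> R) u : f u != 0 -> 0 < deg_norm f.
Proof.
move=> fu; rewrite /deg_norm (bigD1 u) //= ltr_pwDl //.
  by rewrite mulr_gt0 ?cdeg_gt0 // exprn_even_gt0.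
by rewrite sumr_ge0 // => v _; rewrite mulr_ge0 ?sqr_ge0 // ltW ?cdeg_gt0.
Qed.

(** The eigenvalue equation is a second-order recurrence with positive leading weight, so two
    consecutive zeros force the next, all around the cycle. *)
Lemma eigen_zero_propagates mu (g : 'I_N -> R) u :
  signless_eigen mu g -> g u = 0 -> g (ordS u) = 0 -> forall v, g v = 0.
Proof.
move=> eig gu gSu.
have step v : g v = 0 -> g (ordS v) = 0 -> g (ordS (ordS v)) = 0.
  move=> gv gSv; have := eig (ordS v); rewrite ordSK gv gSv !add0r !mulr0 addr0.
  by move=> /eqP; rewrite mulf_eq0 gt_eqF //= => /eqP.
have iterS n : g (iter n (@ordS N) u) = 0 /\ g (iter n.+1 (@ordS N) u) = 0.
  by elim: n => [|n [IH1 IH2]]; split => //=; apply: step.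
have iterE n : iter n (@ordS N) u = ((u + n) %% N)%N :> nat.
  elim: n => [|n IHn] /=; first by rewrite addn0 modn_small.
  by rewrite IHn -addn1 modnDml addn1 addnS.
move=> v; have [+ _] := iterS (v + (N - u))%N; congr (g _ = 0).
apply: val_inj; rewrite /= iterE addnCA subnKC ?(ltnW (ltn_ord u)) //.
by rewrite modnDr modn_small.
Qed.

(* Ground state transform: [g = c f] turns the edge term into
   [- w f f' (c - c')^2]; here [x / 0 = 0] absorbs the zeros of [f]. *)
Lemma ground_state_transform mu (f g : 'I_N -> R) :
    signless_eigen mu f -> (forall u, f u = 0 -> g u = 0) ->
  signless_energy g = mu * deg_norm g -
    \sum_u w u * ((g u * f (ordS u) - g (ordS u) * f u) ^+ 2 / (f u * f (ordS u))).
Proof.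
move=> eig fg.
(* The equation at [u] is multiplied by [g u ^+ 2 / f u] and regrouped by edges. *)
have -> : mu * deg_norm g =
    \sum_u w u * (g u ^+ 2 * (1 + f (ordS u) / f u)
                  + g (ordS u) ^+ 2 * (1 + f u / f (ordS u))).
  rewrite -(sum_edges (fun u v => g u ^+ 2 * (1 + f v / f u))) mulr_sumr.
  apply: eq_bigr => u _; rewrite mulrA.
  have [/fg ->|fu] := eqVneq (f u) 0; first by rewrite expr0n /= !(mul0r, mulr0) addr0.
  have -> : mu * cdeg w u = mu * cdeg w u * f u / f u by rewrite mulfK.
  by rewrite -eig; field.
rewrite -sumrB; apply: eq_bigr => u _.
have [f1|f1] := eqVneq (f u) 0.
  rewrite (fg _ f1) f1 invr0; ring.
have [f2|f2] := eqVneq (f (ordS u)) 0.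
  rewrite (fg _ f2) f2 invr0; ring.
by field; rewrite f1 f2.
Qed.

(** Pair the eigenvalue equation with the restriction and compare edge by edge: edges not crossing
    the boundary of [S] agree, and a crossing edge gains [w u * (f u * f (ordS u))]. *)
Lemma restrict_energy_le mu (f : 'I_N -> R) (S : {set 'I_N}) :
    signless_eigen mu f ->
    (forall u, (u \in S) != (ordS u \in S) -> 0 <= f u * f (ordS u)) ->
  signless_energy (fun u => if u \in S then f u else 0) <=
  mu * deg_norm (fun u => if u \in S then f u else 0).
Proof.
move=> eig bdS; set g := fun u => _.
have -> : mu * deg_norm g =
    \sum_u w u * ((g u + g (ordS u)) * (f u + f (ordS u))).
  have -> : \sum_u w u * ((g u + g (ordS u)) * (f u + f (ordS u))) =
     \sum_u w u * (g u * (f u + f (ordS u)) + g (ordS u) * (f (ordS u) + f u)).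
    by apply: eq_bigr => u _; ring.
  rewrite -(sum_edges (fun u v => g u * (f u + f v))) mulr_sumr.
  apply: eq_bigr => u _; rewrite mulrA.
  have -> : mu * cdeg w u * g u ^+ 2 = g u * (mu * cdeg w u * f u).
    by rewrite /g; case: ifP => _; ring.
  by rewrite -eig; ring.
apply: ler_sum => u _; rewrite ler_pM2l // /g; have := bdS u.
case: (u \in S); case: (ordS u \in S) => /= H; solve [have := H isT; nra | clear H; nra].
Qed.

End SignlessForm.

(** * From the normalized Laplacian to the signless form *)

Section NormalizedLaplacian.
Variables (R : realFieldType) (N : nat) (w : 'I_N -> R).
Hypothesis w_gt0 : forall i, 0 < w i.
Local Notation T := (nlap w)^T.
Local Notation d := (\row_u cdeg w u).

Lemma mul_tr_nlap (x : 'rV[R]_N) u : (x *m T) 0 u =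
  x 0 u - (w u * x 0 (ordS u) + w (ord_pred u) * x 0 (ord_pred u)) / cdeg w u.
Proof.
rewrite -(sum_cw_row w u (x 0)) mxE mulr_suml.
under eq_bigr do rewrite !mxE mulrBr; rewrite sumrB (bigD1 u) //= eqxx mulr1.
rewrite big1 ?addr0 => [|v]; last by rewrite eq_sym => /negbTE ->; rewrite mulr0.
by congr (_ - _); apply: eq_bigr => v _; ring.
Qed.

Lemma signless_eigenP (x : 'rV[R]_N) lam :
  x *m T = lam *: x <-> signless_eigen w (2 - lam) (x 0).
Proof.
have key u : w u * (x 0 u + x 0 (ordS u)) + w (ord_pred u) * (x 0 u + x 0 (ord_pred u))
    = (2 * x 0 u - (x *m T) 0 u) * cdeg w u.
  have d0 := lt0r_neq0 (cdeg_gt0 w_gt0 u).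
  by move: d0; rewrite mul_tr_nlap cdegE => d0; field.
split=> [xT u|eig].
  by rewrite key xT mxE; ring.
apply/rowP => u; rewrite [RHS]mxE.
have d0 := lt0r_neq0 (cdeg_gt0 w_gt0 u).
apply: (mulIf d0).
have := eig u; rewrite key; move: ((x *m T) 0 u) => y e.
have -> : y * cdeg w u = 2 * x 0 u * cdeg w u - (2 * x 0 u - y) * cdeg w u by ring.
by rewrite e; ring.
Qed.

Lemma nlap_self_adjoint : diag_mx d *m T^T = T *m diag_mx d.
Proof.
apply/matrixP => u v; rewrite mul_diag_mx mul_mx_diag !mxE.
have du := lt0r_neq0 (cdeg_gt0 w_gt0 u).
have dv := lt0r_neq0 (cdeg_gt0 w_gt0 v).
have -> : cw w v u = cw w u v by rewrite /cw addrC.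
rewrite mulrBr mulrBl mulrCA divff // mulr1 divfK // eq_sym.
by case: eqP => [->|_]; rewrite ?mulr0 ?mul0r ?mulr1 ?mul1r.
Qed.

Lemma form_energy (x : 'rV[R]_N) : (x *m T *m diag_mx d *m x^T) 0 0 =
  2 * deg_norm w (x 0) - signless_energy w (x 0).
Proof.
have -> : signless_energy w (x 0) =
    deg_norm w (x 0) + \sum_u (w u * (x 0 u * x 0 (ordS u))
                           + w (ord_pred u) * (x 0 u * x 0 (ord_pred u))).
  rewrite (sum_edges w (fun u v => x 0 u * x 0 v)) /deg_norm sum_cdeg -big_split /=.
  by apply: eq_bigr => u _; ring.
rewrite opprD addrA mulr_natl mulr2n addrK -sumrB mxE.
apply: eq_bigr => u _; rewrite mul_mx_diag [X in X * _]mxE mul_tr_nlap !mxE.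
have du := lt0r_neq0 (cdeg_gt0 w_gt0 u).
by rewrite mulrBl divfK //; ring.
Qed.

End NormalizedLaplacian.

(** * Counting the breaks of an eigenvector *)

Section NodalCount.
Variables (R : rcfType) (n' : nat).
Local Notation N := n'.+1.
Variable (w : 'I_N -> R).
Hypothesis w_gt0 : forall i, 0 < w i.

Definition nodal_break (f : 'I_N -> R) : {set 'I_N} :=
  [set j | (f j == 0) || (0 < f (ord_pred j) * f j)].

Lemma sum_delta (g : 'I_N -> R) b : \sum_i g i * (i == b)%:R = g b.
Proof.
rewrite (bigD1 b) //= eqxx mulr1 big1 ?addr0 // => i /negbTE ->.
by rewrite mulr0.
Qed.

(* A vector in the large eigenspan that vanishes at [v0], at the zeros of
   [f], and is locally proportional to [f] across the sign breaks makes the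
   ground state transform nonnegative, hence it is itself an eigenvector whose
   Wronskian with [f] vanishes everywhere. *)
Lemma count_le_nodal_break (lam : seq R) (lam0 : R) (f : 'I_N -> R) :
    char_poly (nlap w) = \prod_(x <- lam) ('X - x%:P) ->
    signless_eigen w (2 - lam0) f -> (exists v, f v != 0) ->
  (count (>= lam0) lam <= #|nodal_break f|.+1)%N.
Proof.
move=> charM eigf [v0 fv0]; rewrite leqNgt; apply/negP => lt_count.
pose s := #|nodal_break f|.
(* One condition per break [b]: [x] vanishes at [b] if [f] does, else the Wronskian of [x] and [f]
   vanishes on the edge entering [b]. With [v0mx] this makes [s + 1] conditions. *)
pose A : 'M[R]_(N, s) := \matrix_(i, j) let b := enum_val j in
  if f b == 0 then (i == b)%:R
  else (i == ord_pred b)%:R * f b - (i == b)%:R * f (ord_pred b).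
pose v0mx : 'M[R]_(N, 1) := \matrix_(i, _) (i == v0)%:R.
have d_gt0 i : 0 < (\row_u cdeg w u) 0 i by rewrite mxE cdeg_gt0.
have charT : char_poly (nlap w)^T = \prod_(x <- lam) ('X - x%:P).
  by rewrite char_poly_tr.
have [|x [x_neq0 xB x_ge x_eig]] := constrained_large_eigenspan d_gt0
  (nlap_self_adjoint w_gt0) (lam0 := lam0) (row_mx A v0mx) charT.
  by rewrite addn1.
move: xB; rewrite mul_mx_row => /eqP; rewrite row_mx_eq0 => /andP[/eqP xA /eqP xv].
have xv0 : x 0 v0 = 0.
  have /rowP/(_ 0) := xv; rewrite !mxE => <-; rewrite -[LHS](sum_delta (x 0) v0).
  by apply: eq_bigr => i _; rewrite mxE.
have xAb b : b \in nodal_break f ->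
    if f b == 0 then x 0 b = 0 else x 0 (ord_pred b) * f b = x 0 b * f (ord_pred b).
  move=> bb; have /rowP/(_ (enum_rank_in bb b)) := xA; rewrite !mxE.
  under eq_bigr do rewrite mxE /= enum_rankK_in //.
  case: eqP => [_|_]; first by rewrite sum_delta.
  under eq_bigr do rewrite mulrBr !mulrA.
  by rewrite sumrB -!mulr_suml !sum_delta => /eqP; rewrite subr_eq0 => /eqP.
have zf u : f u = 0 -> x 0 u = 0.
  by move=> fu; have := xAb u; rewrite inE fu eqxx /= => /(_ isT).
pose Wr u := x 0 u * f (ordS u) - x 0 (ordS u) * f u.
have en := ground_state_transform eigf zf.
(* If [f u * f (ordS u)] is positive, [ordS u] is a break and [Wr u = 0] was imposed; otherwise the
   quotient is nonpositive. *)
have Wr_ge0 u : 0 <= - (w u * (Wr u ^+ 2 / (f u * f (ordS u)))).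
  rewrite oppr_ge0 pmulr_rle0 //.
  have [ff|ff] := lerP (f u * f (ordS u)) 0.
    by rewrite mulr_ge0_le0 ?sqr_ge0 // invr_le0.
  suff -> : Wr u = 0 by rewrite expr0n /= mul0r.
  have f2 : (f (ordS u) == 0) = false by apply: contraTF ff => /eqP ->; rewrite mulr0 ltxx.
  have := xAb (ordS u); rewrite inE ordSK ff orbT f2 => /(_ isT) e.
  by rewrite /Wr e subrr.
have sum_ge0 : 0 <= \sum_u - (w u * (Wr u ^+ 2 / (f u * f (ordS u)))) by rewrite sumr_ge0.
have normE : (x *m diag_mx (\row_u cdeg w u) *m x^T) 0 0 = deg_norm w (x 0).
  by rewrite mul_diag_mx_tr; apply: eq_bigr => u _; rewrite mxE.
move: sum_ge0; rewrite sumrN oppr_ge0 => sum_le0.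
move: x_ge x_eig; rewrite normE form_energy // en => x_ge x_eig.
(* The transform bounds the energy below by [2 - lam0] times the norm, and [x_ge] bounds it above by
   the same value. *)
have sum0 : \sum_u w u * (Wr u ^+ 2 / (f u * f (ordS u))) = 0.
  by apply/eqP; rewrite eq_le sum_le0; move: x_ge; rewrite /Wr; lra.
have /(signless_eigenP w_gt0) eigx : x *m (nlap w)^T = lam0 *: x.
  by apply: x_eig; move: sum0; rewrite /Wr; lra.
have Wr0 u : Wr u = 0.
  have [f1|f1] := eqVneq (f u) 0; first by rewrite /Wr f1 (zf _ f1) mul0r mulr0 subrr.
  have [f2|f2] := eqVneq (f (ordS u)) 0.
    by rewrite /Wr f2 (zf _ f2) mul0r mulr0 subrr.
  have /eqP := congr1 -%R sum0; rewrite oppr0 -sumrN psumr_eq0 // => /allP.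
  move=> /(_ u (mem_index_enum u)) /=; rewrite oppr_eq0 !mulf_eq0 gt_eqF //=.
  by rewrite invr_eq0 mulf_eq0 (negbTE f1) (negbTE f2) /= !orbF orbb => /eqP.
(* As [f] is nonzero at [v0], the zero Wronskian passes the zero of [x] on to the next vertex. *)
have xSv0 : x 0 (ordS v0) = 0.
  have := Wr0 v0; rewrite /Wr xv0 mul0r sub0r => /eqP; rewrite oppr_eq0 mulf_eq0.
  by rewrite (negbTE fv0) orbF => /eqP.
move/eqP: x_neq0; apply; apply/rowP => u; rewrite [RHS]mxE.
exact: (eigen_zero_propagates w_gt0 eigx xv0 xSv0).
Qed.

End NodalCount.

(** * Labelling the arcs between breaks *)

Section NodalLabel.
Variables (R : rcfType) (n' : nat).
Local Notation N := n'.+1.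
Variable (f : 'I_N -> R).
Local Notation s := #|nodal_break f|.

(* The shift by [s.-1] labels the breaks [0, ..., s-1] in increasing order;
   vertices before the first break get the label [s-1] of the last one. *)
Definition nodal_label (i : 'I_N) : nat :=
  ((#|[set j in nodal_break f | (j <= i)%N]| + s.-1) %% s)%N.

Lemma nodal_label_lt i : (0 < s)%N -> (nodal_label i < s)%N.
Proof. by move=> s_gt0; rewrite ltn_mod. Qed.

(** Away from breaks the count is unchanged; from the last vertex to vertex 0 it drops from [s] to
    0, which agree modulo [s]. *)
Lemma nodal_label_ordS u : ordS u \notin nodal_break f ->
  nodal_label (ordS u) = nodal_label u.
Proof.
move=> NSu; rewrite /nodal_label; have [lt_u|ge_u] := ltnP u.+1 N.
  suff -> : [set j in nodal_break f | (j <= ordS u)%N] =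
            [set j in nodal_break f | (j <= u)%N] by [].
  apply/setP => j; rewrite !in_set /= modn_small // [(j <= u.+1)%N]leq_eqVlt ltnS.
  case: (j =P u.+1 :> nat) => //= e; rewrite andbT.
  have -> : j = ordS u by apply: val_inj; rewrite /= modn_small.
  by move: NSu; rewrite inE => /negbTE ->.
have uN : u.+1 = N by apply/eqP; rewrite eqn_leq ge_u ltn_ord.
have -> : [set j in nodal_break f | (j <= u)%N] = nodal_break f.
  by apply/setP => j; rewrite !in_set -ltnS uN ltn_ord andbT.
suff -> : [set j in nodal_break f | (j <= ordS u)%N] = set0.
  by rewrite cards0 add0n modnDl.
apply/setP => j; rewrite !in_set /= uN modnn leqn0; apply/negP => /andP[jb /eqP j0].
by case/negP: NSu; suff <- : j = ordS u; [rewrite inE | apply: val_inj; rewrite /= uN modnn].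
Qed.

Lemma nodal_label_break j : j \in nodal_break f ->
  nodal_label j = #|[set i in nodal_break f | (i < j)%N]|.
Proof.
move=> jb; rewrite /nodal_label (cardsD1 j).
have -> : j \in [set i in nodal_break f | (i <= j)%N] by rewrite in_set jb leqnn.
have -> : [set i in nodal_break f | (i <= j)%N] :\ j =
          [set i in nodal_break f | (i < j)%N].
  by apply/setP => i; rewrite !inE ltn_neqAle -val_eqE andbCA.
have s_gt0 : (0 < s)%N by apply/card_gt0P; exists j.
rewrite -addnA addnCA add1n prednK // modnDr modn_small //.
apply: proper_card; apply/properP; split; first by apply/subsetP => i; rewrite in_set => /andP[].
by exists j => //; rewrite in_set ltnn andbF.
Qed.

(** Labels increase strictly along the breaks, so by cardinality they take all [s] values there. If
    the break found is a zero of [f], its successor is not a break and keeps the label. *)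
Lemma nodal_label_surj l : (forall u, f u = 0 -> f (ordS u) != 0) ->
  (l < s)%N -> exists2 u, f u != 0 & nodal_label u = l.
Proof.
move=> nonadj ls; have s_gt0 : (0 < s)%N by apply: leq_ltn_trans ls.
suff [j jb jl] : exists2 j, j \in nodal_break f & nodal_label j = l.
  have [fj|fj] := eqVneq (f j) 0; last by exists j.
  exists (ordS j); first exact: nonadj.
  rewrite nodal_label_ordS // inE (negbTE (nonadj _ fj)) /= ordSK fj mul0r.
  by rewrite ltxx.
pose g j : 'I_s := Ordinal (nodal_label_lt j s_gt0).
have lt_label i j : i \in nodal_break f -> j \in nodal_break f ->
    (i < j)%N -> (nodal_label i < nodal_label j)%N.
  move=> ib jb ij; rewrite !nodal_label_break //; apply: proper_card.
  apply/properP; split.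
    by apply/subsetP => k; rewrite !in_set => /andP[-> /ltn_trans ->].
  by exists i; [rewrite in_set ib ij | rewrite in_set ltnn andbF].
have inj_g : {in nodal_break f &, injective g}.
  move=> i j ib jb /(congr1 val) /= e; apply: val_inj.
  by case: (ltngtP (val i) (val j)) => // /lt_label; [move=> /(_ ib jb)|move=> /(_ jb ib)];
    rewrite e ltnn.
have /setP/(_ (Ordinal ls)) : g @: nodal_break f = setT.
  by apply/eqP; rewrite eqEcard subsetT cardsT card_ord card_in_imset //=.
by rewrite in_setT => /imsetP[j jb /(congr1 val) /= lj]; exists j.
Qed.

End NodalLabel.

(** * The dual Cheeger inequality *)

Section Cheeger.
Variables (R : realFieldType) (N : nat) (w : 'I_N -> R).
Hypothesis w_gt0 : forall i, 0 < w i.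
Variable g : 'I_N -> R.

(** A total variation in which edges where [g] changes sign cost only a difference. On the indicator
    of a set [A] where [g] has no zero it is [cvol w A] times [1 - phibar] of the two sign parts of
    [A]. *)
Definition sign_variation (h : 'I_N -> R) : R :=
  \sum_u w u * (if g u * g (ordS u) < 0 then `|h u - h (ordS u)|
                else h u + h (ordS u)).

Local Notation ind A := (fun u => (u \in (A : {set 'I_N}))%:R : R).

(* Layer cake: peel off the constant [min h] on the support of [h], which is
   linear in both sides, and induct on the size of the support. *)
Lemma coarea_le theta (S : {set 'I_N}) :
    (forall A : {set 'I_N}, A != set0 -> A \subset S ->
      theta * cvol w A <= sign_variation (ind A)) ->
  forall h : 'I_N -> R, (forall u, 0 <= h u) -> (forall u, u \notin S -> h u = 0) ->
    theta * (\sum_u cdeg w u * h u) <= sign_variation h.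
Proof.
move=> indS h; have [m] := ubnP #|[set u | h u != 0]|.
elim: m h => // m IHm h le_m h_ge0 hS.
pose A := [set u | h u != 0].
have hA u : u \notin A -> h u = 0 by rewrite inE negbK => /eqP.
have [A0|[i0 i0A]] := set_0Vmem A.
  have h0 u : h u = 0 by apply: hA; rewrite A0 inE.
  rewrite big1 ?mulr0 => [|u _]; last by rewrite h0 mulr0.
  by rewrite sumr_ge0 // => u _; rewrite !h0 subrr normr0 addr0 if_same mulr0.
have [i /= iA i_min] := arg_minP h i0A; have {}iA : i \in A by [].
pose h' u := h u - h i * (u \in A)%:R.
have hi_gt0 : 0 < h i by rewrite lt_neqAle h_ge0 eq_sym andbT; move: iA; rewrite inE.
have h'_ge0 u : 0 <= h' u.
  rewrite /h'; have [uA|/hA ->] := boolP (u \in A); last by rewrite mulr0 subrr.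
  by rewrite mulr1 subr_ge0 i_min.
have -> : sign_variation h = sign_variation h' + h i * sign_variation (ind A).
  rewrite mulr_sumr -big_split /=; apply: eq_bigr => u _.
  rewrite mulrCA -mulrDr; congr (_ * _); have := h'_ge0 u; have := h'_ge0 (ordS u).
  rewrite /h'.
  have [uA|/hA ->] := boolP (u \in A); have [SuA|/hA ->] := boolP (ordS u \in A);
    rewrite ?(mulr0, mulr1, subr0, sub0r, subrr, addr0, add0r, oppr0) => h1 h2;
    case: ifP => _; rewrite ?(normrN, normr1, normr0, mulr1, mulr0, addr0) //.
  - by rewrite opprB addrA subrK.
  - by rewrite /=; ring.
  - by rewrite (ger0_norm h2) ger0_norm // subrK.
  - by rewrite subrK.
  - by rewrite (ger0_norm h1) ger0_norm // subrK.
  - by rewrite subrK.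
have -> : \sum_u cdeg w u * h u = \sum_u cdeg w u * h' u + h i * cvol w A.
  rewrite /cvol mulr_sumr [X in _ + X]big_mkcond -big_split /=; apply: eq_bigr => u _.
  by rewrite /h'; case: ifP => _ /=; ring.
have AS : A \subset S.
  apply/subsetP => u; rewrite inE => hu; apply/negPn/negP => /hS hu0.
  by rewrite hu0 eqxx in hu.
rewrite mulrDr lerD //; last first.
  by rewrite mulrCA ler_pM2l // indS //; apply/set0Pn; exists i0.
apply: IHm => //; last first.
  move=> u uS; have uA : (u \in A) = false by apply: contraNF uS; apply: (subsetP AS).
  by rewrite /h' hS // uA mulr0 subrr.
rewrite -ltnS (leq_trans _ le_m) // ltnS; apply: proper_card; apply/properP; split.
  apply/subsetP => u; rewrite !inE; apply: contra_neq => hu.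
  by rewrite /h' inE hu eqxx mulr0 subrr.
by exists i => //; rewrite inE negbK /h' iA mulr1 subrr.
Qed.

Local Notation pos A := (A :&: [set u | 0 < g u]).
Local Notation neg A := (A :&: [set u | g u < 0]).

Lemma sum_in_ind (A : {set 'I_N}) (h : 'I_N -> R) :
  \sum_(u in A) h u = \sum_u h u * (u \in A)%:R.
Proof.
by rewrite big_mkcond; apply: eq_bigr => u _; case: ifP; rewrite ?mulr1 ?mulr0.
Qed.

Lemma sign_variation_ind (A : {set 'I_N}) : {in A, forall u, g u != 0} ->
  sign_variation (ind A) = cvol w A - 2 * cE w (pos A) (neg A).
Proof.
move=> gA.
have -> : cE w (pos A) (neg A) =
    \sum_u w u * ((ordS u \in neg A)%:R * (u \in pos A)%:R +
                  (u \in neg A)%:R * (ordS u \in pos A)%:R).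
  rewrite -(sum_edges w (fun u v => (v \in neg A)%:R * (u \in pos A)%:R)).
  rewrite /cE sum_in_ind; apply: eq_bigr => u _.
  by rewrite sum_in_ind sum_cw_row mulrDl !mulrA.
rewrite /cvol sum_in_ind sum_cdeg.
rewrite mulr_sumr -sumrB; apply: eq_bigr => u _.
rewrite mulrCA -mulrBr; congr (_ * _); rewrite !inE.
have := gA u; have := gA (ordS u).
case: (u \in A); case: (ordS u \in A) => /= H1 H2;
  rewrite ?(mulr0, mul0r, subr0, addr0, add0r, sub0r, normrN, normr1, normr0, oppr0, if_same) //.
move: {H1 H2} (H1 isT) (H2 isT); case: (ltgtP (g u) 0) => // gu;
  case: (ltgtP (g (ordS u)) 0) => // gSu _ _.
- by rewrite ltNge ltW ?nmulr_rgt0 //=; ring.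
- by rewrite nmulr_rlt0 // gSu subrr normr0 /=; ring.
- by rewrite pmulr_rlt0 // gSu subrr normr0 /=; ring.
- by rewrite ltNge ltW ?mulr_gt0 //=; ring.
Qed.

Lemma cvol_gt0 (A : {set 'I_N}) : A != set0 -> 0 < cvol w A.
Proof.
move=> /set0Pn[u uA]; rewrite /cvol (bigD1 u) //= ltr_pwDl ?cdeg_gt0 //.
by rewrite sumr_ge0 // => v _; rewrite ltW ?cdeg_gt0.
Qed.

(** If no [A] worked, the layer cake bound for the square of [g] would give [theta * deg_norm w g]
    at most its sign variation. An edgewise estimate bounds [theta] times that variation by
    [signless_energy w g + theta ^+ 2 / 2 * deg_norm w g], whence [theta ^+ 2 <= 2 * mu]. *)
Lemma dual_cheeger mu theta : 0 < deg_norm w g ->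
    signless_energy w g <= mu * deg_norm w g ->
    0 < theta -> 2 * mu < theta ^+ 2 ->
  exists A : {set 'I_N}, [/\ A != set0, A \subset [set u | g u != 0] &
    1 - theta < phibar w (pos A) (neg A)].
Proof.
move=> nrm_gt0 le_mu th_gt0 lt_th; set S := [set u | g u != 0].
have [/existsP[A /and3P[]]|] := boolP [exists A : {set 'I_N},
    [&& A != set0, A \subset S & 1 - theta < phibar w (pos A) (neg A)]].
  by exists A.
rewrite negb_exists => /forallP noA.
have indS (A : {set 'I_N}) : A != set0 -> A \subset S ->
    theta * cvol w A <= sign_variation (ind A).
  move=> A0 AS; have gA : {in A, forall u, g u != 0}.
    by move=> u /(subsetP AS); rewrite inE.
  rewrite sign_variation_ind //; have := noA A; rewrite A0 AS /= -leNgt.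
  rewrite /phibar; have -> : pos A :|: neg A = A.
    apply/setP => u; rewrite !inE -andb_orr; have := gA u.
    by case: (u \in A) => //= /(_ isT); rewrite neq_lt orbC.
  rewrite ler_pdivrMr ?cvol_gt0 // => H; lra.
have := coarea_le indS (h := fun u => g u ^+ 2) (fun u => sqr_ge0 _).
have gS u : u \notin S -> g u ^+ 2 = 0.
  by rewrite inE negbK => /eqP ->; rewrite expr0n.
move=> /(_ gS); rewrite -/(deg_norm w g) => le_sv.
suff : theta * sign_variation (fun u => g u ^+ 2) <=
    signless_energy w g + theta ^+ 2 / 2 * deg_norm w g.
  move=> H; exfalso; have H1 : theta * (theta * deg_norm w g) <=
    theta * sign_variation (fun u => g u ^+ 2) by rewrite ler_pM2l.
  by clear - H H1 le_mu lt_th nrm_gt0; nra.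
rewrite /deg_norm sum_cdeg !mulr_sumr -big_split /=; apply: ler_sum => u _.
rewrite mulrCA [_ / 2 * _]mulrCA -mulrDr ler_pM2l //.
move: (g u) (g (ordS u)) => p q.
(* On a sign change, factor [p ^+ 2 - q ^+ 2] and complete the square; otherwise use [0 <= p * q]
   and [theta <= 1 + theta ^+ 2 / 2]. *)
rewrite -subr_ge0; case: ifP => pq.
  have [_|_] := ger0P (p ^+ 2 - q ^+ 2).
    have -> : (p + q) ^+ 2 + theta ^+ 2 / 2 * (p ^+ 2 + q ^+ 2) - theta * (p ^+ 2 - q ^+ 2)
      = (p + q - theta / 2 * (p - q)) ^+ 2 + (theta / 2 * (p + q)) ^+ 2 by field.
    by rewrite addr_ge0 ?sqr_ge0.
  have -> : (p + q) ^+ 2 + theta ^+ 2 / 2 * (p ^+ 2 + q ^+ 2) - theta * (- (p ^+ 2 - q ^+ 2))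
    = (p + q + theta / 2 * (p - q)) ^+ 2 + (theta / 2 * (p + q)) ^+ 2 by field.
  by rewrite addr_ge0 ?sqr_ge0.
have {}pq : 0 <= p * q by rewrite leNgt pq.
have -> : (p + q) ^+ 2 + theta ^+ 2 / 2 * (p ^+ 2 + q ^+ 2) - theta * (p ^+ 2 + q ^+ 2)
  = p * q *+ 2 + ((1 - theta) ^+ 2 + 1) / 2 * (p ^+ 2 + q ^+ 2) by field.
by rewrite addr_ge0 ?mulrn_wge0 // !mulr_ge0 ?invr_ge0 ?addr_ge0 ?sqr_ge0.
Qed.

End Cheeger.

(** * Disjoint pairs from disjoint supports *)

Section HigherDualCheeger.
Variables (R : realFieldType) (N : nat) (w : 'I_N -> R).
Hypothesis w_gt0 : forall i, 0 < w i.

Lemma minphi_le_hbar k (c : {ffun 'I_k -> {set 'I_N} * {set 'I_N}}) :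
  admissible c -> minphi w c <= hbar w k.
Proof. by move=> adm; rewrite /hbar; apply: le_bigmax_cond. Qed.

Lemma hbar_le1 k : hbar w k <= 1.
Proof.
rewrite /hbar; apply: bigmax_le => // c _; rewrite /minphi.
exact: bigmin_le_id.
Qed.

(** Otherwise the dual Cheeger inequality with [theta = 1 - hbar w k], applied to each restriction
    of [f], yields an admissible collection whose [phibar] all exceed [hbar w k]. *)
Lemma higher_dual_cheeger k mu (f : 'I_N -> R) (S : 'I_k -> {set 'I_N}) :
    signless_eigen w mu f -> (exists u, f u != 0) ->
    (forall i, exists2 u, u \in S i & f u != 0) ->
    (forall i j, i != j -> [disjoint S i & S j]) ->
    (forall i u, (u \in S i) != (ordS u \in S i) -> 0 <= f u * f (ordS u)) ->
  (1 - hbar w k) ^+ 2 <= 2 * mu.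
Proof.
move=> eig [v fv] Sf disjS bdS; rewrite leNgt; apply/negP => lt_mu.
set theta := 1 - hbar w k in lt_mu.
have restrict A := restrict_energy_le (S := A) w_gt0 eig.
(* For [g = f] the transform has zero Wronskians, so the energy is [mu] times the norm. This
   excludes [theta = 0] below. *)
have mu_ge0 : 0 <= mu.
  have en : 0 <= signless_energy w f.
    by rewrite sumr_ge0 // => u _; rewrite mulr_ge0 ?sqr_ge0 // ltW.
  rewrite -(pmulr_lge0 _ (deg_norm_gt0 w_gt0 fv)) (le_trans en) //.
  rewrite (ground_state_transform eig (fun _ e => e)) big1 ?subr0 // => u _.
  by rewrite [f (ordS u) * _]mulrC subrr expr0n /= mul0r mulr0.
have th_gt0 : 0 < theta.
  have : 0 <= theta by rewrite subr_ge0 hbar_le1.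
  rewrite le_eqVlt => /orP[/eqP th0|//].
  by move: lt_mu; rewrite -th0 expr0n /= ltNge mulr_ge0.
pose g i u := if u \in S i then f u else 0.
have /fin_all_exists[A HA] : forall i, exists A : {set 'I_N},
   [/\ A != set0, A \subset [set u | g i u != 0] &
    1 - theta < phibar w (A :&: [set u | 0 < g i u]) (A :&: [set u | g i u < 0])].
  move=> i; apply: (dual_cheeger w_gt0 (mu := mu)) => //.
    have [u uS fu] := Sf i; apply: (deg_norm_gt0 w_gt0 (u := u)).
    by rewrite /g uS.
  exact/restrict/bdS.
have AS i : A i \subset S i.
  have [_ + _] := HA i; move=> /subset_trans; apply; apply/subsetP => u.
  by rewrite inE /g; case: ifP => //; rewrite eqxx.
pose c : {ffun 'I_k -> {set 'I_N} * {set 'I_N}} :=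
  [ffun i => (A i :&: [set u | 0 < g i u], A i :&: [set u | g i u < 0])].
have adm : admissible c.
  apply/andP; split; apply/forallP => i.
    rewrite ffunE /=; have [A0 Ag _] := HA i; apply/andP; split.
      rewrite -setI_eq0; apply/eqP/setP => u; rewrite !inE.
      by case: (ltgtP (g i u) 0); rewrite ?(andbF, andFb).
    have /set0Pn[u uA] := A0; apply/set0Pn; exists u; rewrite !inE uA /=.
    by have := subsetP Ag _ uA; rewrite inE neq_lt orbC.
  apply/forallP => j; apply/implyP => /disjS dS; rewrite !ffunE /=.
  have dA (B C : {set 'I_N}) : [disjoint A i :&: B & A j :&: C].
    apply: disjointWl (subset_trans (subsetIl _ _) (AS i)) _.
    exact: disjointWr (subset_trans (subsetIl _ _) (AS j)) dS.
  by rewrite !dA.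
have := minphi_le_hbar adm; rewrite leNgt => /negP; apply.
have -> : hbar w k = 1 - theta by rewrite /theta opprB addrC subrK.
(* The default 1 of the minimum also has to exceed [1 - theta]. *)
rewrite /minphi; apply: lt_bigmin; first by rewrite ltrBlDr ltrDl.
by move=> i _; rewrite ffunE /=; have [] := HA i.
Qed.
End HigherDualCheeger.

(** * Assembling the eigenvalue bound *)

Lemma count_ge_sorted (R : realFieldType) (s : seq R) i :
  sorted <=%R s -> (i < size s)%N -> (size s - i <= count (>= s`_i)%R s)%N.
Proof.
move=> srt lt_i; rewrite -[X in count _ X](cat_take_drop i) count_cat.
have /eqP -> : count (>= s`_i) (drop i s) == size (drop i s).
  rewrite -all_count; apply/(all_nthP 0) => j; rewrite size_drop ltn_subRL nth_drop => lt_ij.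
  by apply: (sorted_leq_nth le_trans le_refl 0 srt); rewrite ?inE // leq_addr.
by rewrite size_drop leq_addl.
Qed.

Lemma sqr_one_sub_hbar_le (R : rcfType) (n' k : nat) (N := n'.+1) (w : 'I_N -> R)
    (lam : seq R) :
    (forall i, 0 < w i) -> eigenvalues_sorted (nlap w) lam -> (1 <= k <= N)%N ->
  (1 - hbar' w (k - 1)%N) ^+ 2 <= 2 * (2 - lam`_(N - k)).
Proof.
move=> w_gt0 [sz srt charM] /andP[k_gt0 k_le].
set lam0 := lam`_(N - k).
have lt_k : (N - k < size lam)%N by rewrite sz -subn_gt0 subKn.
have [x [xT x_neq0]] : exists x : 'rV[R]_N, x *m (nlap w)^T = lam0 *: x /\ x != 0.
  have : eigenvalue (nlap w)^T lam0.
    by rewrite eigenvalue_root_char char_poly_tr charM root_prod_XsubC mem_nth.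
  by case/eigenvalueP => x xT x0; exists x.
pose f := x 0.
have eig : signless_eigen w (2 - lam0) f by apply/signless_eigenP.
have fv : exists v, f v != 0.
  by case/rV0Pn: x_neq0 => v xv; exists v.
(* For [k = 1] the convention gives the same [hbar w 1] as [k = 2]; the set of all vertices has no
   boundary edge. *)
have [k_le2|k_gt2] := leqP k 2.
  have -> : hbar' w (k - 1)%N = hbar w 1.
    by rewrite /hbar'; case: k k_gt0 k_le2 {k_le lam0 lt_k xT eig} => [|[|[|]]].
  apply: (higher_dual_cheeger (k := 1) w_gt0 (S := fun=> setT) eig) => //.
  - by move=> _; case: fv => v fv; exists v.
  - by move=> i j; rewrite !ord1 eqxx.
  - by move=> _ u; rewrite !in_setT.
(* The last [k] eigenvalues are at least [lam0], so [k] is at most the number of breaks plus 1. *)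
have lt_s : (k - 1 <= #|nodal_break f|)%N.
  rewrite leq_subLR add1n.
  apply: leq_trans (count_le_nodal_break w_gt0 charM eig fv).
  by rewrite -[X in (X <= _)%N](subKn k_le) -[X in (X - _)%N]sz count_ge_sorted.
have nonadj u : f u = 0 -> f (ordS u) != 0.
  move=> fu; apply/eqP => fSu; case: fv => v /eqP; apply.
  exact: (eigen_zero_propagates w_gt0 eig fu fSu).
have -> : hbar' w (k - 1)%N = hbar w (k - 1)%N.
  by rewrite /hbar' subn_eq0 leqNgt (ltn_trans _ k_gt2).
pose S (i : 'I_(k - 1)) := [set u | (f u != 0) && (nodal_label f u == i)].
apply: (higher_dual_cheeger w_gt0 (S := S) eig) => //.
- move=> i; have [|u fu lu] := nodal_label_surj (l := i) nonadj.
    exact: leq_trans (ltn_ord i) lt_s.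
  by exists u => //; rewrite inE fu lu eqxx.
- move=> i j ij; rewrite -setI_eq0; apply/eqP/setP => u; rewrite !inE.
  apply/negP => /andP[/andP[_ /eqP ei] /andP[_ /eqP ej]].
  by case/eqP: ij; apply: val_inj; rewrite /= -ei -ej.
(* Across a strict sign change neither end is a zero of [f] and the second is not a break, so both
   carry the same label. *)
- move=> i u; apply: contraR; rewrite -ltNge => ff; rewrite !inE.
  have fu : f u != 0 by apply: contraTneq ff => ->; rewrite mul0r ltxx.
  have fSu : f (ordS u) != 0 by apply: contraTneq ff => ->; rewrite mulr0 ltxx.
  by rewrite fu fSu nodal_label_ordS // inE (negbTE fSu) /= ordSK -leNgt ltW.
Qed.

(* lam`_(j-1) is lambda_j; lambda_{N-k+1} = lam`_(N-k). *)
Theorem theorem7p1 (R : rcfType) (N : nat) (w : 'I_N -> R)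
  (lam : seq R) (k : nat) :
  (3 <= N)%N ->
  (forall i, 0 < w i) ->
  eigenvalues_sorted (nlap w) lam ->
  (1 <= k <= N)%N ->
  let m := (N - k + 1)%N in
  let C3 : R := if odd m || (N - 1 <= m)%N then 1 / 2 else 1 / 48 in
  2 - lam`_(N - k) >= C3 * (1 - hbar' w (k - 1)%N) ^+ 2.
Proof.
case: N w => // n' w _ w_gt0 eigs k_bd; cbv zeta; set C3 : R := if _ then _ else _.
have := sqr_one_sub_hbar_le w_gt0 eigs k_bd.
have C3_le : C3 <= 1 / 2 by rewrite /C3; case: ifP => _; lra.
have := sqr_ge0 (1 - hbar' w (k - 1)%N); move: (_ ^+ 2) => h h_ge0 le_h.
have : C3 * h <= 1 / 2 * h by rewrite ler_wpM2r.
by lra.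
Qed.
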